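(* There are positive constants $a$ and $A$ such that for all integers $n>2$, $$a\,\frac{n^2}{S(n)}\le \pi(n)\le A\,\frac{n^2}{S(n)}.$$
   Context: Let $\varphi$ be Euler's totient function. The height function $H$ on positive integers is defined by $H(1)=0$ and $H(n)=H(\varphi(n))+1$ for $n\ge 2$. Let $S(n)=\sum_{k=1}^n H(k)$, and let $\pi(n)$ be the number of primes $\le n$. *)

(* Defs.v *)
From mathcomp Require Import all_boot.

Set Implicit Arguments.
Unset Strict Implicit.
Unset Printing Implicit Defensive.

(* The first argument is recursion fuel; since totient n < n for 1 < n, fuel n
   suffices for n, and height satisfies the defining recursion by height1 and
   heightE below. *)
Fixpoint height_rec (fuel n : nat) : nat :=
  if fuel is fuel'.+1 then
    if n <= 1 then 0 else (height_rec fuel' (totient n)).+1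
  else 0.

Definition height (n : nat) : nat := height_rec n n.

Definition height_sum (n : nat) : nat := \sum_(1 <= k < n.+1) height k.

Definition prime_pi (n : nat) : nat := \sum_(1 <= p < n.+1 | prime p) 1.

Lemma totient_lt n : 1 < n -> totient n < n.
Proof.
move=> n_gt1; rewrite totient_count_coprime.
case: n n_gt1 => [//|n] n_gt1; rewrite big_nat_recl //.
rewrite /coprime gcdn0 gtn_eqF // add0n ltnS.
have sum1 : \sum_(0 <= i < n) 1 = n by rewrite sum_nat_const_nat muln1 subn0.
apply: leq_trans (_ : \sum_(0 <= i < n) 1 <= n); last by rewrite sum1.
by apply: leq_sum => i _; exact: leq_b1.
Qed.

Lemma height_rec_fuel f g n :
  n <= f -> n <= g -> height_rec f n = height_rec g n.
Proof.
elim: f g n => [|f IHf] [|g] n //=; rewrite ?leqn0.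
- by move=> /eqP->.
- by move=> _ /eqP->.
move=> n_f n_g; case: leqP => // n_gt1.
have lt_n := totient_lt n_gt1.
by congr _.+1; apply: IHf; rewrite -ltnS; apply: leq_trans lt_n _.
Qed.

Lemma height1 : height 1 = 0.
Proof. by []. Qed.

Lemma heightE n : 2 <= n -> height n = height (totient n) + 1.
Proof.
case: n => [//|n] n_ge2; rewrite {1}/height /= leqNgt n_ge2 addn1 /=.
by congr _.+1; apply: height_rec_fuel; rewrite // -ltnS totient_lt.
Qed.

(* Main.v *)
Require Import Defs.
From mathcomp Require Import all_boot all_order all_algebra.
From mathcomp Require Import reals zify.

(* Shapiro's observation: the number f(n) of even terms in n, phi(n),
   phi(phi(n)), ... is completely additive, because phi(pn) is p phi(n) or
   (p - 1) phi(n) and f(p) = f(p - 1) for odd p.  As f(2) = 1, induction over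
   prime factors gives 2^f(n) <= n <= 3^f(n); since H(n) - f(n) is 0 or 1, S(n)
   is of order n log n.  The claim is thus Chebyshev's theorem that
   pi(n) is of order n / log n, whose lower half comes from C(n, k) <= n^pi(n) (Legendre)
   and whose upper half comes from the primes in (n/2, n] dividing
   C(n, n/2) <= 2^n. *)

(** * The height function *)

Lemma totient_primeM p n : prime p -> 0 < n ->
  totient (p * n) = (if p %| n then p else p.-1) * totient n.
Proof.
move=> pr_p n_gt0; case: ifPn => [p_dv_n|pNn]; last first.
  by rewrite totient_coprime ?prime_coprime // totient_prime.
have [m co_pm En] := pfactor_coprime pr_p n_gt0.
have e_gt0 : 0 < logn p n by rewrite logn_gt0 mem_primes pr_p n_gt0.
move: (logn p n) e_gt0 En => [//|e] _ ->.
have co_mX k : coprime m (p ^ k) by rewrite coprime_sym coprimeXl.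
have -> : p * (m * p ^ e.+1) = m * p ^ e.+2 by rewrite (expnS p e.+1) mulnCA.
rewrite !(totient_coprime (co_mX _)) !totient_pfactor //= (expnS p e); lia.
Qed.

(** Split off the least prime factor [p], with cofactor [m]. The factor 2 or an even [p.-1] settles
    it, unless [p] is 2 and [m] odd, or [p] is odd and divides [m]; then [2 < m] and induction
    applies. *)
Lemma odd_totient n : 2 < n -> odd (totient n) = false.
Proof.
elim/ltn_ind: n => n IH n_gt2.
have pr_p := pdiv_prime (ltnW n_gt2); set p := pdiv n in pr_p.
have [m En] : exists m, n = p * m.
  by exists (n %/ p); rewrite mulnC divnK // pdiv_dvd.
have p_gt1 := prime_gt1 pr_p.
have m_gt0 : 0 < m by move: n_gt2; rewrite En; case: (m); rewrite ?muln0.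
rewrite En totient_primeM // oddM.
have [p2|odd_p] := even_prime pr_p.
  case: ifPn => [_|]; first by rewrite p2.
  rewrite p2 dvdn2 negbK => odd_m.
  by rewrite IH ?andbF //; move: n_gt2; rewrite En p2; lia.
case: ifPn => [p_dv_m|_]; last by rewrite -subn1 oddB ?odd_p // ltnW.
have p_gt2 := odd_prime_gt2 odd_p pr_p.
have le_pm : p <= m by exact: dvdn_leq.
by rewrite IH ?andbF //; rewrite ?En; nia.
Qed.

(* The number of even terms in the iterated totient sequence of n. *)
Definition even_height (n : nat) : nat := height n - (odd n && (1 < n)).

(** Only the starting value can be an odd term above 1: for [n > 2] the next term is even, so its
    correction vanishes. *)
Lemma even_height_totient n : 0 < n ->
  even_height n = even_height (totient n) + ~~ odd n.
Proof.
case: n => [//|[|[|n]]] _ //.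
rewrite /even_height (odd_totient n.+3) //= subn0 heightE //.
by case: (odd n) => /=; rewrite ?subn0 ?addnK ?addn0.
Qed.

Lemma even_heightM m n : 0 < m -> 0 < n ->
  even_height (m * n) = even_height m + even_height n.
Proof.
have [N le_mnN] := ubnP (m * n).
elim: N => // N IH in m n le_mnN * => m_gt0 n_gt0.
(* Prime factor first: the totient of [p * k] is a product smaller than [p * k], so the induction
   hypothesis splits it, and only parities remain to be compared. *)
have prM p k : prime p -> 0 < k -> p * k <= N ->
    even_height (p * k) = even_height p + even_height k.
  move=> pr_p k_gt0 le_pkN.
  have p_gt1 := prime_gt1 pr_p; have p_gt0 := ltnW p_gt1.
  have tk_gt0 : 0 < totient k by rewrite totient_gt0.
  have Epk : even_height (p * k) =
      even_height (totient (p * k)) + ~~ odd (p * k).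
    by rewrite even_height_totient // muln_gt0 p_gt0.
  have Ep := even_height_totient p p_gt0.
  have Ek := even_height_totient k k_gt0.
  rewrite totient_prime // in Ep.
  rewrite Epk totient_primeM //.
  have [k1|k_neq1] := eqVneq k 1.
    by rewrite k1 Euclid_dvd1 // !muln1 Ep addn0.
  have tk_lt : totient k < k by apply: totient_lt; lia.
  case: ifPn => [p_dv_k|pNk].
    rewrite IH //; last by apply: leq_trans le_pkN; rewrite ltn_pmul2l.
    rewrite Ek -addnA; congr (_ + (_ + _)).
    have [p2|odd_p] := even_prime pr_p; last by rewrite oddM odd_p.
    by move: p_dv_k; rewrite p2 oddM dvdn2 => ->.
  have p1_gt0 : 0 < p.-1 by lia.
  rewrite IH //; last by apply: leq_trans le_pkN; apply: ltn_mul; lia.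
  rewrite Ep Ek oddM.
  have [p2|odd_p] := even_prime pr_p; last by rewrite odd_p /=; lia.
  by move: pNk; rewrite p2 dvdn2 negbK => ->; rewrite /=; lia.
(* General case: write [m] as [p * k] and apply [prM] to [p * (k * n)] and to [p * k], with
   induction on [k * n] in between. *)
have [m1|m_neq1] := eqVneq m 1; first by rewrite m1 mul1n.
have [n1|n_neq1] := eqVneq n 1; first by rewrite n1 muln1 addn0.
have m_gt1 : 1 < m by lia.
have pr_p := pdiv_prime m_gt1.
have [k Em] : exists k, m = pdiv m * k.
  by exists (m %/ pdiv m); rewrite mulnC divnK // pdiv_dvd.
move: (pdiv m) pr_p Em => p pr_p Em.
have k_gt0 : 0 < k by move: m_gt0; rewrite Em muln_gt0 => /andP[].
have p_gt1 := prime_gt1 pr_p.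
have kn_gt0 : 0 < k * n by rewrite muln_gt0 k_gt0.
have k_le : k * n < m * n by rewrite Em -mulnA ltn_Pmull.
rewrite Em -mulnA prM //; last by rewrite mulnA -Em.
rewrite IH //; last by lia.
rewrite prM ?addnA //.
by rewrite -Em; apply: leq_trans (leq_pmulr m n_gt0) _.
Qed.

Lemma even_height_bounds n : 0 < n ->
  2 ^ even_height n <= n <= 3 ^ even_height n.
Proof.
elim/ltn_ind: n => n IH n_gt0.
have [->//|n_neq1] := eqVneq n 1.
have n_gt1 : 1 < n by lia.
have [pr_n|npr_n] := boolP (prime n); last first.
  have pr_p := pdiv_prime n_gt1.
  have [k En] : exists k, n = pdiv n * k.
    by exists (n %/ pdiv n); rewrite mulnC divnK // pdiv_dvd.
  move: (pdiv n) pr_p En => p pr_p En.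
  have p_gt1 := prime_gt1 pr_p.
  have k_gt0 : 0 < k by move: n_gt0; rewrite En muln_gt0 => /andP[].
  have k_gt1 : 1 < k.
    rewrite ltn_neqAle k_gt0 andbT eq_sym; apply/eqP => k1.
    by move: npr_n; rewrite En k1 muln1 pr_p.
  have /andP[lp up] : 2 ^ even_height p <= p <= 3 ^ even_height p.
    by apply: IH; rewrite ?En; nia.
  have /andP[lk uk] : 2 ^ even_height k <= k <= 3 ^ even_height k.
    by apply: IH; rewrite ?En; nia.
  by rewrite En even_heightM ?expnD ?leq_mul // ltnW.
have [->//|odd_n] := even_prime pr_n.
have n_gt2 := odd_prime_gt2 odd_n pr_n.
have Ef : even_height n = even_height n.-1.
  by rewrite even_height_totient // totient_prime // odd_n addn0.
(* For an odd prime, [even_height] is one more than at [m], and 2m <= 2m + 1 <= 3m carries both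
   bounds over from [m]. *)
have [m Em] : exists m, n = (2 * m).+1.
  by exists n./2; rewrite -[LHS]odd_double_half odd_n mul2n.
have m_gt0 : 0 < m by lia.
have Ef1 : even_height n.-1 = (even_height m).+1 by rewrite Em /= even_heightM.
have /andP[lm um] : 2 ^ even_height m <= m <= 3 ^ even_height m.
  by apply: IH; rewrite ?Em; lia.
rewrite Ef Ef1 !expnS; apply/andP; split; lia.
Qed.

(** * The order of S(n) *)

Lemma height_even_height n : height n <= (even_height n).+1.
Proof. by rewrite /even_height; case: (_ && _); lia. Qed.

Lemma height_sum_le n : height_sum n <= n * (trunc_log 2 n).+1.
Proof.
rewrite /height_sum.
suff H k : 1 <= k < n.+1 -> height k <= (trunc_log 2 n).+1.
  rewrite big_nat; apply: leq_trans (leq_sum _ H) _.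
  by rewrite -big_nat sum_nat_const_nat subn1.
move=> /andP[k_gt0 le_kn]; apply: leq_trans (height_even_height k) _.
have /andP[lk _] := even_height_bounds k k_gt0.
by rewrite ltnS; apply: trunc_log_max => //; apply: leq_trans lk _.
Qed.

(** The terms with k > n/2 suffice: there are at least n/2 of them, each at least (L + 1)/4, whence
    the 8. *)
Lemma height_sum_ge n : 2 < n -> n * (trunc_log 2 n).+1 <= 8 * height_sum n.
Proof.
move=> n_gt2; set L := trunc_log 2 n.
have H k : n./2.+1 <= k < n.+1 -> L.+1 <= 4 * height k.
  move=> /andP[lt_nk le_kn].
  have k_gt1 : 1 < k by lia.
  have h_gt0 : 0 < height k by rewrite heightE // addn1.
  have /andP[_ uk] := even_height_bounds k (ltnW k_gt1).
  (* From k <= 3^f(k) <= 4^H(k). With 2^L <= n < 2k this gives L + 1 <= 2 H(k) + 2, which is at most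
     4 H(k) as H(k) >= 1. *)
  have k_lt : k < 2 ^ (2 * height k).+1.
    apply: leq_ltn_trans uk _; rewrite expnS expnM.
    have le1 : 3 ^ even_height k <= 4 ^ even_height k.
      by have [->//|f_gt0] := posnP (even_height k); rewrite leq_exp2r.
    have le2 : 4 ^ even_height k <= 4 ^ height k by rewrite leq_exp2l // leq_subr.
    have p_gt0 : 0 < 4 ^ height k by rewrite expn_gt0.
    by move: le1 le2 p_gt0; rewrite -[2 ^ 2]/4; lia.
  have : 2 ^ L < 2 ^ (2 * height k).+2.
    have nL : 2 ^ L <= n by apply: trunc_logP; lia.
    by move: nL k_lt; rewrite (expnS 2 (2 * height k).+1); lia.
  by rewrite ltn_exp2l //; lia.
have : \sum_(n./2.+1 <= k < n.+1) L.+1 <=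
    \sum_(n./2.+1 <= k < n.+1) 4 * height k.
  by rewrite big_nat [leqRHS]big_nat; apply: leq_sum.
rewrite sum_nat_const_nat -big_distrr /= => le1.
have : \sum_(n./2.+1 <= k < n.+1) height k <= height_sum n.
  have le_n : n./2.+1 <= n.+1 by lia.
  by rewrite /height_sum (@big_cat_nat _ _ _ n./2.+1 1) //= leq_addl.
have le_n : n <= 2 * (n.+1 - n./2.+1) by lia.
move=> le2; apply: leq_trans (leq_mul le_n (leqnn _)) _.
rewrite -mulnA; lia.
Qed.

(** * Chebyshev's estimates *)

Lemma prime_pi_count n : prime_pi n = count prime (index_iota 1 n.+1).
Proof. by rewrite /prime_pi sum1_count. Qed.

(** The added terms of Legendre's formula vanish since p^i > i > n. A common range lets the three
    factorials in a binomial coefficient be compared term by term. *)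
Lemma logn_fact_widen p n m : prime p -> n <= m ->
  logn p n`! = \sum_(1 <= i < m.+1) n %/ p ^ i.
Proof.
move=> pr_p le_nm; rewrite logn_fact // (@big_cat_nat _ _ _ n.+1 1 m.+1) //=.
rewrite [X in _ = _ + X]big1_seq ?addn0 // => i.
rewrite mem_index_iota => /= /andP[lt_ni _].
by rewrite divn_small // (ltn_trans lt_ni) // ltn_expl // prime_gt1.
Qed.

Lemma divnD_le d m n : 0 < d ->
  (m + n) %/ d <= m %/ d + n %/ d + (d <= m + n).
Proof.
move=> d_gt0; case: (leqP d (m + n)) => [_|lt_mnd]; last by rewrite divn_small.
by rewrite divnD // leq_add2l leq_b1.
Qed.

(** By Legendre's formula the exponent counts carries: each i contributes at most 1, and nothing
    once p^i > n. *)
Lemma pfactor_bin_le p n k : prime p -> 0 < n -> k <= n ->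
  p ^ logn p 'C(n, k) <= n.
Proof.
move=> pr_p n_gt0 le_kn; have p_gt1 := prime_gt1 pr_p.
suff le_log : logn p 'C(n, k) <= trunc_log p n.
  by apply: leq_trans (trunc_logP p_gt1 n_gt0); rewrite leq_exp2l.
have := congr1 (logn p) (bin_fact le_kn).
rewrite !lognM ?muln_gt0 ?fact_gt0 ?bin_gt0 //.
rewrite !(@logn_fact_widen p _ n) ?leq_subr // => Elog.
have le_sum : \sum_(1 <= i < n.+1) n %/ p ^ i <=
    \sum_(1 <= i < n.+1) (k %/ p ^ i + (n - k) %/ p ^ i + (p ^ i <= n)).
  apply: leq_sum => i _; have := @divnD_le (p ^ i) k (n - k).
  by rewrite subnKC // expn_gt0 prime_gt0 //; apply.
have le_cnt : \sum_(1 <= i < n.+1) (p ^ i <= n) <= trunc_log p n.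
  have le_T : trunc_log p n <= n.
    apply: leq_trans (trunc_logP p_gt1 n_gt0).
    by apply: ltnW; apply: ltn_expl.
  rewrite (@big_cat_nat _ _ _ (trunc_log p n).+1) //=.
  rewrite [X in _ + X]big1_seq ?addn0 => [|i]; last first.
    rewrite mem_index_iota => /= /andP[lt_Ti _].
    by case: leqP => // /(trunc_log_max p_gt1); rewrite leqNgt lt_Ti.
  apply: leq_trans (_ : \sum_(1 <= i < (trunc_log p n).+1) 1 <= _).
    by apply: leq_sum => i _; apply: leq_b1.
  by rewrite sum_nat_const_nat muln1 subn1.
by move: le_sum; rewrite !big_split /= -Elog; lia.
Qed.

(** The binomial coefficient is a product of at most pi(n) prime powers, each at most n. *)
Lemma bin_le_prime_pi n k : 0 < n -> k <= n -> 'C(n, k) <= n ^ prime_pi n.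
Proof.
move=> n_gt0 le_kn; have C_gt0 : 0 < 'C(n, k) by rewrite bin_gt0.
rewrite {1}(prod_prime_decomp C_gt0) prime_decompE big_map /=.
have pP p : p \in primes 'C(n, k) -> prime p /\ p <= n.
  rewrite -logn_gt0 => lp_gt0; have := lp_gt0.
  rewrite logn_gt0 mem_primes => /andP[pr_p _]; split=> //.
  apply: leq_trans (@pfactor_bin_le p n k pr_p n_gt0 le_kn).
  by rewrite -{1}(expn1 p) leq_exp2l // prime_gt1.
apply: leq_trans (_ : \prod_(p <- primes 'C(n, k)) n <= _).
  rewrite big_seq [leqRHS]big_seq; apply: leq_prod => p /pP[pr_p _].
  exact: pfactor_bin_le.
rewrite big_const_seq count_predT iter_muln_1.
rewrite leq_pexp2l // prime_pi_count -size_filter.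
apply: uniq_leq_size (primes_uniq _) _ => p /pP[pr_p le_pn].
by rewrite mem_filter pr_p mem_index_iota ltnS le_pn prime_gt0.
Qed.

Lemma prime_pi_gt0 n : 1 < n -> 0 < prime_pi n.
Proof.
move=> n_gt1; rewrite prime_pi_count -has_count.
by apply/hasP; exists 2 => //; rewrite mem_index_iota.
Qed.

Lemma prime_pi_ge n : 1 < n -> n <= 2 * ((trunc_log 2 n).+1 * prime_pi n).
Proof.
move=> n_gt1; have n_gt0 := ltnW n_gt1; set L := (trunc_log 2 n).+1.
have lt_nL : n < 2 ^ L by exact: trunc_log_ltn.
have P_gt0 := prime_pi_gt0 _ n_gt1.
(* The n + 1 binomial coefficients sum to 2^n, and both n + 1 and n are at most 2^L; the lone [L] is
   absorbed since pi(n) >= 1. *)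
suff : 2 ^ n <= 2 ^ (L + L * prime_pi n).
  rewrite leq_exp2l // => /leq_trans-> //.
  by rewrite mul2n -addnn leq_add2r leq_pmulr.
rewrite expnD expnM.
apply: leq_trans (_ : n.+1 * n ^ prime_pi n <= _); last first.
  by apply: leq_mul => //; rewrite leq_exp2r // ltnW.
rewrite -[2]/(1 + 1) expnDn.
apply: leq_trans (_ : \sum_(i < n.+1) n ^ prime_pi n <= _).
  by apply: leq_sum => i _; rewrite !exp1n !muln1 bin_le_prime_pi // -ltnS.
by rewrite sum_nat_const card_ord.
Qed.

(** * Upper bound for pi(n) from primorials *)

Definition primorial (n : nat) : nat := \prod_(1 <= p < n.+1 | prime p) p.

Lemma prod_primes_dvdn (s : seq nat) N :
  uniq s -> (forall p, p \in s -> prime p && (p %| N)) -> \prod_(p <- s) p %| N.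
Proof.
elim: s => [|p s IH] /=; first by rewrite big_nil dvd1n.
move=> /andP[pNs uniq_s] sP; rewrite big_cons.
have /andP[pr_p p_dv] := sP p (mem_head _ _).
rewrite Gauss_dvd ?p_dv ?IH // => [q sq|]; first by rewrite sP // inE sq orbT.
rewrite prime_coprime // big_seq Euclid_dvd_prod // big_has_cond.
apply/negP => /hasP[q sq] /andP[_].
have /andP[pr_q _] : prime q && (q %| N) by rewrite sP // inE sq orbT.
by rewrite dvdn_prime2 // => /eqP Epq; rewrite Epq sq in pNs.
Qed.

Lemma prime_dvd_fact p n : prime p -> (p %| n`!) = (p <= n).
Proof.
move=> pr_p; apply/idP/idP => [|le_pn]; last first.
  by apply: dvdn_fact; rewrite prime_gt0.
elim: n => [|n IH]; first by rewrite dvdn1 => /eqP p1; rewrite p1 in pr_p.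
rewrite factS Euclid_dvdM // => /orP[/dvdn_leq->//|/IH/leq_trans->//].
Qed.

Lemma bin_le_exp2 n k : 'C(n, k) <= 2 ^ n.
Proof.
elim: n k => [|n IH] [|k] //; rewrite ?bin0 ?expn_gt0 //.
by rewrite binS expnS mul2n -addnn leq_add.
Qed.

(** A prime in ([uphalf n], [n]] divides n! but neither factorial in the denominator of
    ['C(n, n./2)], as both have argument at most [uphalf n]. *)
Lemma primorial_step n : primorial n <= primorial (uphalf n) * 2 ^ n.
Proof.
have le_un : uphalf n <= n by lia.
rewrite /primorial (@big_cat_nat _ _ _ (uphalf n).+1) //=.
apply: leq_mul => //; apply: leq_trans (bin_le_exp2 n n./2).
have le_hn : n./2 <= n by lia.
apply: dvdn_leq; first by rewrite bin_gt0.
rewrite -big_filter; apply: prod_primes_dvdn => [|p].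
  by rewrite filter_uniq // iota_uniq.
rewrite mem_filter mem_index_iota => /andP[pr_p /andP[lt_up lt_pn]].
rewrite pr_p /=.
have : p %| n`! by rewrite prime_dvd_fact.
rewrite -(bin_fact le_hn) !Euclid_dvdM // !prime_dvd_fact //.
by rewrite ![p <= _]leqNgt; case: (p %| _) => //=; lia.
Qed.

Lemma primorial_le n : primorial n <= 8 ^ n.
Proof.
elim/ltn_ind: n => n; case: n => [|[|[|n]]] IH; try by rewrite /primorial unlock.
have lt_u : uphalf n.+3 < n.+3 by lia.
apply: leq_trans (primorial_step _) _.
apply: leq_trans (leq_mul (IH _ lt_u) (leqnn _)) _.
(* The exponents need 3 * [uphalf n] <= 2n, true from n = 3 on; smaller n were computed. *)
by rewrite -[8]/(2 ^ 3) -!expnM -expnD leq_exp2l //; lia.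
Qed.

Lemma prime_pi_leq n : prime_pi n <= n.
Proof.
by rewrite prime_pi_count (leq_trans (count_size _ _)) // size_iota subn1.
Qed.

Lemma primorial_gt0 n : 0 < primorial n.
Proof. by apply: prodn_cond_gt0 => p; apply: prime_gt0. Qed.

(** At most k primes are <= k, so at least pi(n) - k primes in (k, n] contribute a factor above k.
    For k > n the truncated exponent is 0. *)
Lemma expn_prime_pi_le n k : 0 < k -> k ^ (prime_pi n - k) <= primorial n.
Proof.
move=> k_gt0; have [le_kn|lt_nk] := leqP k n; last first.
  have /eqP -> : prime_pi n - k == 0.
    by rewrite subn_eq0 (leq_trans (prime_pi_leq n)) // ltnW.
  exact: primorial_gt0.
rewrite /primorial (@big_cat_nat _ _ _ k.+1) //=.
apply: leq_trans (leq_pmull _ (primorial_gt0 k)).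
apply: leq_trans (_ : \prod_(k.+1 <= p < n.+1 | prime p) k <= _); last first.
  rewrite big_nat_cond [leqRHS]big_nat_cond.
  by apply: leq_prod => p /andP[/andP[lt_kp _] _]; apply: ltnW.
rewrite big_const_seq iter_muln_1 leq_pexp2l // leq_subLR.
rewrite /prime_pi (@big_cat_nat _ _ _ k.+1 1 n.+1) //= !sum1_count leq_add2r -prime_pi_count.
exact: prime_pi_leq.
Qed.

Lemma prime_pi_le n : 0 < n -> (trunc_log 2 n).+1 * prime_pi n <= 18 * n.
Proof.
move=> n_gt0; have le_Pn := prime_pi_leq n.
have le_Ln : 2 ^ trunc_log 2 n <= n by exact: trunc_logP.
(* The cut-off 2^h is about the square root of n: its logarithm keeps the order of log n, while h *
   2^h <= 4^h <= n stays negligible. *)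
set L := trunc_log 2 n in le_Ln *; set h := L./2; set P := prime_pi n in le_Pn *.
have K_gt0 : 0 < 2 ^ h by rewrite expn_gt0.
have le_pow : 2 ^ (h * (P - 2 ^ h)) <= 2 ^ (3 * n).
  rewrite !expnM; apply: leq_trans (@expn_prime_pi_le n _ K_gt0) _.
  exact: primorial_le.
rewrite leq_exp2l // in le_pow.
have le_hK : h * 2 ^ h <= n.
  apply: leq_trans le_Ln; apply: leq_trans (_ : 2 ^ (h + h) <= _).
    by rewrite expnD leq_mul2r ltnW ?orbT // ltn_expl.
  by rewrite leq_exp2l // /h; lia.
have le_hP : h * P <= 4 * n.
  apply: leq_trans (_ : h * (P - 2 ^ h) + h * 2 ^ h <= _); last by lia.
  by rewrite -mulnDr leq_mul2l; lia.
(* Here 4hP <= 16n and 2P <= 2n add up to 18n. *)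
have le_L : L.+1 <= 4 * h + 2 by rewrite /h; lia.
apply: leq_trans (leq_mul le_L (leqnn P)) _.
rewrite mulnDl -mulnA; lia.
Qed.

(** * Combining the estimates *)

Import Order.TTheory GRing.Theory Num.Theory.
Local Open Scope ring_scope.

Theorem theorem4p3 (R : realType) :
  exists a A : R, 0 < a /\ 0 < A /\
    forall n : nat, (2 < n)%N ->
      a * (n%:R ^+ 2 / (height_sum n)%:R) <= (prime_pi n)%:R /\
      (prime_pi n)%:R <= A * (n%:R ^+ 2 / (height_sum n)%:R).
Proof.
(* With L = [(trunc_log 2 n).+1]: n^2 <= 2P * nL <= 16PS, and PS <= n * LP <= 18n^2. *)
exists (16%:R^-1), 18%:R; split; first by rewrite invr_gt0 ltr0n.
split; first by rewrite ltr0n.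
move=> n n_gt2.
have n_gt0 : (0 < n)%N by lia.
have leS := height_sum_le n; have geS := height_sum_ge n n_gt2.
have leP := prime_pi_le n n_gt0; have geP := prime_pi_ge n (ltnW n_gt2).
move: (height_sum n) (prime_pi n) (trunc_log 2 n).+1
  (ltn0Sn (trunc_log 2 n)) leS geS leP geP.
move=> S P L L_gt0 leS geS leP geP.
have S_gt0 : (0 < S)%N by nia.
have S_gt0R : 0 < S%:R :> R by rewrite ltr0n.
rewrite (mulrA 16%:R^-1) (mulrA 18%:R) ler_pdivrMr // ler_pdivlMr // ler_pdivrMl ?ltr0n //.
rewrite -!natrX -!natrM !ler_nat -!mulnn; split.
  apply: leq_trans (leq_mul (leqnn n) geP) _.
  have := leq_mul (leqnn P) geS; lia.
apply: leq_trans (leq_mul (leqnn P) leS) _.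
have := leq_mul (leqnn n) leP; lia.
Qed.
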